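(* Let $h\geq 5$ and $k\geq 3h+4$ be positive integers. Let $A$ be a finite set of $k$ integers such that $\min(A)=0$, $\gcd(A)=1$, and $|h^{\wedge}A| = hk-h^2+4$. Then $A=[0,k+2]\setminus\{x,y,z\}$, where $\{x,y,z\}$ is one of the sets $\{1,2,3\}$, $\{k-1,k,k+1\}$, $\{1,2,k+1\}$, $\{1,k,k+1\}$, $\{1,3,k+2\}$, $\{k-2,k,k+2\}$, $\{2,k,k+2\}$, $\{1,k-1,k+2\}$, $\{3,k+1,k+2\}$, $\{k-3,k+1,k+2\}$.
   Context: For a finite set $A$ of integers and a positive integer $h\le |A|$, the restricted $h$-fold sumset $h^{\wedge}A$ is the set of all sums of $h$ distinct elements of $A$. For integers $\alpha\le\beta$, $[\alpha,\beta]=\{x\in\mathbb{Z}:\alpha\le x\le\beta\}$. $\gcd(A)$ denotes the greatest common divisor of the elements of $A$. *)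

(* Defs.v *)
From HB Require Import structures.
From mathcomp Require Import all_boot all_order all_algebra.
From mathcomp Require Import finmap zify.
Set Implicit Arguments.
Unset Strict Implicit.
Unset Printing Implicit Defensive.
Import Order.TTheory GRing.Theory Num.Theory.
Local Open Scope fset_scope.
Local Open Scope ring_scope.

(* Sums of h distinct elements of A, i.e. sums over the h-element subsets. *)
Definition rsumset (h : nat) (A : {fset int}) : {fset int} :=
  (fun B : {fset int} => \sum_(x <- B) x) @`
    [fset B in fpowerset A | #|` B| == h].

Definition fset_gcd (A : {fset int}) : int := \big[gcdz/0]_(a <- A) a.

(* The interval of integers [a, b], empty when b < a. *)
Definition zint (a b : int) : {fset int} :=
  [fset a + i%:Z | i in iota 0 (if a <= b then `|b - a|%N.+1 else 0%N)].

Lemma in_rsumset (h : nat) (A : {fset int}) (s : int) :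
  reflect (exists B : {fset int},
             [/\ B `<=` A, #|` B| = h & s = \sum_(x <- B) x])
          (s \in rsumset h A).
Proof.
apply: (iffP (imfsetP _ _ _ _)) => /= [[B] | [B [sBA cB ->]]].
  by rewrite !inE fpowersetE => /andP[sBA /eqP cB] ->; exists B.
by exists B; rewrite // !inE fpowersetE sBA cB eqxx.
Qed.

Lemma dvdz_fset_gcd (A : {fset int}) (d : int) :
  reflect (forall a, a \in A -> (d %| a)%Z) (d %| fset_gcd A)%Z.
Proof.
have -> : (d %| fset_gcd A)%Z = all (fun a => d %| a)%Z A.
  rewrite /fset_gcd; elim: (enum_fset A) => [|a s IHs].
    by rewrite big_nil dvdz0.
  by rewrite big_cons dvdz_gcd IHs.
exact: allP.
Qed.

Lemma in_zint (a b x : int) : (x \in zint a b) = (a <= x <= b).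
Proof.
apply/imfsetP/idP => /= [[i] | /andP[ax xb]].
  by rewrite mem_iota; case: ifP; lia.
by exists `|x - a|%N; [rewrite mem_iota; case: ifP; lia | lia].
Qed.

(* Main.v *)
(** Write A as a_0 < ... < a_(k-1) and regard h of the indices as particles on
    the path 0, ..., k-1.  Moving a particle to a larger free position increases
    both the sum of the chosen a_i and the sum of the positions, the latter by
    h(k-h) in all between the lowest and the highest configuration.  Hence
    "number of sums below the current one, minus sum of the positions" never
    decreases along such moves, and the hypothesis on |h^A| says that it
    increases by at most 3 altogether.  If two distant gaps a_(i+1) - a_i differ,
    moving one particle across each in either order gives an extra sum; when
    both gaps are at distance >= 3 from the ends, five particles can do this
    four times, so all these gaps equal some d.  A particle crossing an outer
    gap while another one makes four steps of size d shows that this gap is d,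
    2d, 3d or 4d, and gcd(A) = 1 forces d = 1.  Finally, if g_i denotes the gap
    at distance i from one of the ends (i = 0, 1, 2), the sums cover an interval
    as particles cross the outer gaps, so the sum of (i + 1)(g_i - 1) over both
    ends is at most 3, and it is at least 3 as all sums lie between the lowest
    and the highest one.  The solutions of this equation are the ten cases. *)

Require Import Defs.
From mathcomp Require Import all_boot all_order all_algebra finmap.
From mathcomp Require Import zify.
Import Order.TTheory GRing.Theory Num.Theory.
Local Open Scope fset_scope.
Local Open Scope ring_scope.

(** * Configurations of particles and the extremal ones *)

Section Configurations.

Context (h k : nat) (a : nat -> int) (S : seq int).

(** Positions are listed in any order, so that a permutation can bring the moving particle to the
    head. *)
Definition config (s : seq nat) : bool :=
  [&& uniq s, size s == h & all (fun i => (i < k)%N) s].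

Definition ssum (s : seq nat) : int := \sum_(i <- s) a i.

Definition gap (x : nat) : int := a x.+1 - a x.

Definition below (v : int) : nat := count (fun s => s < v) S.

(* Up to a constant, the number of sums below [ssum s] in excess of those forced
   by any chain of moves from the lowest configuration to [s]. *)
Definition excess (s : seq nat) : int := (below (ssum s))%:Z - (sumn s)%:Z.

Lemma ssum_cons x s : ssum (x :: s) = a x + ssum s.
Proof. exact: big_cons. Qed.

Lemma ssum_cat s t : ssum (s ++ t) = ssum s + ssum t.
Proof. exact: big_cat. Qed.

Lemma config_perm s t : perm_eq s t -> config s = config t.
Proof.
by move=> st; rewrite /config (perm_uniq st) (perm_size st) (perm_all _ st).
Qed.

Lemma ssum_perm s t : perm_eq s t -> ssum s = ssum t.
Proof. exact: perm_big. Qed.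

Lemma excess_perm s t : perm_eq s t -> excess s = excess t.
Proof. by move=> st; rewrite /excess (ssum_perm _ _ st) (perm_sumn st). Qed.

Lemma config_head {x y s} : config (x :: s) -> (y < k)%N -> y \notin s ->
  config (y :: s).
Proof. by rewrite /config /= => /and3P[/andP[_ ->] -> /andP[_ ->]] -> ->. Qed.

(** Parks the other [h - n] particles outside [U] once and for all, so that they never block [n]
    particles moving inside [U]. *)
Lemma config_padding (U : seq nat) (n : nat) : (n <= h)%N ->
  (size U + (h - n) <= k)%N ->
  exists R, forall l, uniq l -> size l == n -> all (fun i => (i < k)%N) l ->
    {subset l <= U} -> config (l ++ R).
Proof.
move=> nh Uk; pose F : seq nat := [seq i <- iota 0 k | i \notin U].
have sF : (k - size U <= size F)%N.
  have kF : (size [seq i <- iota 0 k | i \in U] + size F = k)%N.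
    by rewrite !size_filter (count_predC (mem U)) size_iota.
  suff : (size [seq i <- iota 0 k | i \in U] <= size U)%N by lia.
  apply: uniq_leq_size; first by rewrite filter_uniq ?iota_uniq.
  by move=> i; rewrite mem_filter => /andP[].
exists (take (h - n) F) => l ul /eqP sl lk lU.
have RF i : i \in take (h - n) F -> i \notin U /\ (i < k)%N.
  by move=> /mem_take; rewrite mem_filter mem_iota add0n => /andP[].
apply/and3P; split.
- rewrite cat_uniq ul take_uniq ?filter_uniq ?iota_uniq // andbT /=.
  by apply/hasPn => i /RF[iU _]; apply: contra iU; apply: lU.
- by rewrite size_cat sl size_takel ?subnKC //; lia.
- by rewrite all_cat lk; apply/allP => i /RF[].
Qed.

(** As long as some particle sits at [y >= h], some site [x < h] is free by pigeonhole. Moving it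
    from [y] down to [x] does not raise [F] and lowers the position sum. *)
Lemma config_min (F : seq nat -> int) (hk : (h <= k)%N) :
  (forall s t, perm_eq s t -> F s = F t) ->
  (forall x y s, config (x :: s) -> config (y :: s) -> (x <= y)%N ->
    F (x :: s) <= F (y :: s)) ->
  forall s, config s -> F (iota 0 h) <= F s.
Proof.
move=> Fperm Fmono s; have [n] := ubnP (sumn s); elim: n s => // n IHn s sn cs.
have /and3P[us /eqP ss /allP sk] := cs.
have [/allP small|/allPn[y ys]] := boolP (all (fun i => (i < h)%N) s).
  rewrite (Fperm s (iota 0 h)) //; apply: uniq_perm; rewrite ?iota_uniq //.
  have sub : {subset s <= iota 0 h} by move=> i /small; rewrite mem_iota.
  by have [|_] := uniq_min_size us sub; rewrite ?size_iota ?ss.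
rewrite -leqNgt => hy.
have [/allP full|/allPn[x]] := boolP (all (mem s) (iota 0 h)).
  have : (size (y :: iota 0 h) <= size s)%N.
    apply: uniq_leq_size; first by rewrite /= mem_iota iota_uniq; lia.
    by move=> i; rewrite inE => /orP[/eqP->|/full].
  by rewrite /= size_iota ss ltnn.
rewrite mem_iota add0n /= => xh xs; have sy := perm_to_rem ys.
have xs' : x \notin rem y s by apply: contra xs; apply: mem_rem.
have cy : config (y :: rem y s) by rewrite -(config_perm _ _ sy).
have cx : config (x :: rem y s) by apply: config_head cy _ xs'; lia.
rewrite (Fperm _ _ sy); apply: le_trans (Fmono x y _ cx cy _); last by lia.
by apply: IHn => //; move: sn; rewrite (perm_sumn sy) /=; lia.
Qed.

Lemma config_max (F : seq nat -> int) (hk : (h <= k)%N) :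
  (forall s t, perm_eq s t -> F s = F t) ->
  (forall x y s, config (x :: s) -> config (y :: s) -> (x <= y)%N ->
    F (x :: s) <= F (y :: s)) ->
  forall s, config s -> F s <= F (iota (k - h) h).
Proof.
move=> Fperm Fmono s; have [n] := ubnP (h * k - sumn s)%N.
elim: n s => // n IHn s sn cs.
have /and3P[us /eqP ss /allP sk] := cs.
have [/allP large|/allPn[y ys]] := boolP (all (fun i => (k - h <= i)%N) s).
  rewrite (Fperm s (iota (k - h) h)) //; apply: uniq_perm; rewrite ?iota_uniq //.
  have sub : {subset s <= iota (k - h) h}.
    by move=> i si; rewrite mem_iota; move: (large i si) (sk i si); lia.
  by have [|_] := uniq_min_size us sub; rewrite ?size_iota ?ss.
rewrite -ltnNge => hy.
have [/allP full|/allPn[x]] := boolP (all (mem s) (iota (k - h) h)).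
  have : (size (y :: iota (k - h) h) <= size s)%N.
    apply: uniq_leq_size; first by rewrite /= mem_iota iota_uniq; lia.
    by move=> i; rewrite inE => /orP[/eqP->|/full].
  by rewrite /= size_iota ss ltnn.
rewrite mem_iota /= => xh xs; have sy := perm_to_rem ys.
have xs' : x \notin rem y s by apply: contra xs; apply: mem_rem.
have cy : config (y :: rem y s) by rewrite -(config_perm _ _ sy).
have cx : config (x :: rem y s) by apply: config_head cy _ xs'; lia.
(* Position sums are at most [h * k], so the truncated difference used as induction measure really
   decreases. *)
have bound t : all (fun i => (i < k)%N) t -> (sumn t <= size t * k)%N.
  by elim: t => //= i t IHt /andP[ik /IHt]; rewrite mulSn; lia.
rewrite (Fperm _ _ sy); apply: le_trans (Fmono y x _ cy cx _) _; first by lia.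
apply: IHn => //; have /and3P[_ /eqP sx /bound] := cx.
by rewrite sx; move: sn; rewrite (perm_sumn sy) /=; lia.
Qed.

(** * Monotonicity and total growth of the excess *)

Hypothesis h_le_k : (h <= k)%N.
Hypothesis a_incr : forall i j, (i < j)%N -> (j < k)%N -> a i < a j.
Hypothesis ssumS : forall s, config s -> ssum s \in S.
Hypothesis uniqS : uniq S.
Hypothesis sizeS : (size S)%:Z = h%:Z * (k%:Z - h%:Z) + 4.

Lemma below_add {v w} l : uniq l -> {subset l <= S} ->
  {in l, forall x, v <= x < w} -> v <= w -> (below v + size l <= below w)%N.
Proof.
move=> ul lS lvw vw; rewrite /below -!size_filter -size_cat.
apply: uniq_leq_size => [|x].
  rewrite cat_uniq filter_uniq // ul andbT /=; apply/hasPn => x /lvw xvw.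
  by rewrite mem_filter; lia.
rewrite mem_cat !mem_filter => /orP[/andP[xv ->]|xl]; first by lia.
by rewrite (lS _ xl); have := lvw _ xl; lia.
Qed.

Lemma sumn_iota m p n : sumn (iota (m + p) n) = (n * m + sumn (iota p n))%N.
Proof. by elim: n p => //= n IHn p; rewrite -addnS IHn mulSn; lia. Qed.

(** The sum before the step lies below the one after it, so the count grows by at least 1, as the
    position sum does. *)
Lemma excess_step x s : config (x :: s) -> config (x.+1 :: s) ->
  excess (x :: s) <= excess (x.+1 :: s).
Proof.
move=> cx cy; rewrite /excess /=.
have /and3P[_ _ /andP[yk _]] := cy.
have lt : ssum (x :: s) < ssum (x.+1 :: s).
  by rewrite !ssum_cons; have := a_incr _ _ (ltnSn x) yk; lia.
have := @below_add (ssum (x :: s)) (ssum (x.+1 :: s)) [:: ssum (x :: s)] isT.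
have sub : {subset [:: ssum (x :: s)] <= S}.
  by move=> z; rewrite inE => /eqP->; apply: ssumS.
have bnd : {in [:: ssum (x :: s)],
    forall z, ssum (x :: s) <= z < ssum (x.+1 :: s)}.
  by move=> z; rewrite inE => /eqP->; rewrite lexx.
by move=> /(_ sub bnd (ltW lt)) /=; lia.
Qed.

Lemma perm_mid {l1 l2 : seq nat} {x} :
  perm_eq (l1 ++ x :: l2) (x :: l1 ++ l2).
Proof. by rewrite perm_catC /= perm_cons perm_catC. Qed.

(** Particles are interchangeable: if the last site [z] before the target is occupied, its particle
    makes the final step and the moving one stops at [z]. *)
Lemma excess_move x y s : config (x :: s) -> config (y :: s) -> (x <= y)%N ->
  excess (x :: s) <= excess (y :: s).
Proof.
move=> cx cy xy; rewrite -(subnKC xy) in cy *.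
elim: (y - x)%N s cx cy => {y xy} [|n IHn] s cx cy; first by rewrite addn0.
rewrite addnS in cy *; set z := (x + n)%N in cy *.
have /and3P[/= /andP[ys us] ss /andP[yk sk]] := cy.
have [zs|zs] := boolP (z \in s); last first.
  have cz : config (z :: s) by apply: config_head cx _ zs; lia.
  exact: le_trans (IHn _ cx cz) (excess_step _ _ cz cy).
have sz := perm_to_rem zs; set s' := rem _ s in sz.
have p1 : perm_eq (x :: s) [:: z, x & s'].
  by apply: perm_trans (@perm_mid [:: x] s' z); rewrite perm_cons.
have p2 : perm_eq (z.+1 :: s) [:: z, z.+1 & s'].
  by apply: perm_trans (@perm_mid [:: z.+1] s' z); rewrite perm_cons.
have p3 : perm_eq [:: z.+1, x & s'] [:: x, z.+1 & s'] by exact: (@perm_mid [:: _]).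
rewrite (excess_perm _ _ p1) (excess_perm _ _ p2).
rewrite (config_perm _ _ p1) in cx; rewrite (config_perm _ _ p2) in cy.
have cm : config [:: z.+1, x & s'].
  apply: config_head cx _ _ => //; rewrite inE negb_or; apply/andP; split.
    by rewrite /z; lia.
  by apply: contra ys; apply: mem_rem.
apply: le_trans (excess_step _ _ cx cm) _; rewrite (excess_perm _ _ p3).
by apply: IHn; rewrite // -(config_perm _ _ p3).
Qed.

Lemma excess_jump l1 x y l2 : config (l1 ++ x :: l2) ->
  config (l1 ++ y :: l2) -> (x <= y)%N ->
  excess (l1 ++ x :: l2) <= excess (l1 ++ y :: l2).
Proof.
rewrite !(config_perm _ _ perm_mid) !(excess_perm _ _ perm_mid).
exact: excess_move.
Qed.

Lemma config_iota m : (m + h <= k)%N -> config (iota m h).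
Proof.
move=> mk; rewrite /config iota_uniq size_iota eqxx /=.
by apply/allP => i; rewrite mem_iota; lia.
Qed.

(** The extremal configurations bound the excess. Their position sums differ by [h(k-h)], and the
    top sum is not below itself, so at most [h(k-h) + 3] sums lie below it. *)
Lemma excess_le s t : config s -> config t -> excess t <= excess s + 3.
Proof.
move=> cs ct.
have := config_min excess h_le_k excess_perm excess_move s cs.
have := config_max excess h_le_k excess_perm excess_move t ct.
have : (below (ssum (iota (k - h) h)) < size S)%N.
  rewrite -(count_predC (fun x => x < ssum (iota (k - h) h)) S) -addn1 leq_add2l.
  rewrite -has_count; apply/hasP; exists (ssum (iota (k - h) h)).
    by apply: ssumS; apply: config_iota; lia.
  by rewrite /= ltxx.
have := sumn_iota (k - h) 0 h.
have : h%:Z * (k%:Z - h%:Z) = (h * (k - h))%N by rewrite PoszM subzn.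
by rewrite /excess addn0; lia.
Qed.

(** Unequal gaps make the two intermediate sums distinct. With the initial sum this gives three sums
    below the final one, against a rise of 2 in the position sum. *)
Lemma excess_diamond l1 x y l2 :
  config (l1 ++ [:: x, y & l2]) -> config (l1 ++ [:: x.+1, y & l2]) ->
  config (l1 ++ [:: x, y.+1 & l2]) -> config (l1 ++ [:: x.+1, y.+1 & l2]) ->
  gap x <> gap y ->
  excess (l1 ++ [:: x, y & l2]) + 1 <= excess (l1 ++ [:: x.+1, y.+1 & l2]).
Proof.
move=> c00 c10 c01 c11; rewrite /gap => gxy.
have /and3P[_ _] := c11; rewrite all_cat => /and4P[_ xk yk _].
have gx := a_incr _ _ (ltnSn x) xk; have gy := a_incr _ _ (ltnSn y) yk.
have sE u v : ssum (l1 ++ [:: u, v & l2]) = a u + a v + ssum (l1 ++ l2).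
  by rewrite !ssum_cat !ssum_cons; lia.
have /= := @below_add (ssum (l1 ++ [:: x, y & l2]))
  (ssum (l1 ++ [:: x.+1, y.+1 & l2]))
  [:: ssum (l1 ++ [:: x, y & l2]); ssum (l1 ++ [:: x.+1, y & l2]);
      ssum (l1 ++ [:: x, y.+1 & l2])].
rewrite /excess !sumn_cat /= => below3.
suff : (below (ssum (l1 ++ [:: x, y & l2])) + 3 <=
        below (ssum (l1 ++ [:: x.+1, y.+1 & l2])))%N by lia.
apply: below3; rewrite ?sE ?inE; try lia.
- by move=> z; rewrite !inE -!sE => /or3P[] /eqP->; apply: ssumS.
- by move=> z; rewrite !inE => /or3P[] /eqP->; lia.
Qed.

(** * Comparison of gaps *)

Definition five_in (p q : nat) (l : seq nat) : bool :=
  [&& uniq l, size l == 5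
    & all (fun i => (p <= i <= p + 4) || (q <= i <= q + 4))%N l].

Local Ltac five_in_tac := rewrite /five_in /= !inE; lia.

(* Five particles in single file: while one crosses from q to q+1, the next one
   crosses from p+3 to p+4. *)
Lemma gap_far p q : (5 <= h)%N -> (h + 5 <= k)%N -> (p + 5 <= q)%N ->
  (q + 4 < k)%N -> gap p.+3 = gap q.
Proof.
move=> h5 hk5 pq qk; apply/eqP; apply: contraT => /eqP gpq.
have gqp : gap q <> gap p.+3 by move=> /esym.
have [R cR] : exists R, forall l, five_in p q l -> config (l ++ R).
  have [||R cR] := @config_padding (iota p 5 ++ iota q 5) 5 => //=; first by lia.
  exists R => l /and3P[ul sl /allP lpq]; apply: cR => //.
    by apply/allP => i /lpq; lia.
  by move=> i /lpq; rewrite mem_cat !mem_iota; lia.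
have J l1 x y l2 :
    five_in p q (l1 ++ x :: l2) && five_in p q (l1 ++ y :: l2) && (x <= y)%N ->
    excess ((l1 ++ x :: l2) ++ R) <= excess ((l1 ++ y :: l2) ++ R).
  move=> /andP[/andP[/cR cx /cR cy] xy]; move: cx cy.
  by rewrite -!catA; move=> cx cy; apply: excess_jump.
have D l1 l2 :
    five_in p q (l1 ++ [:: q, p.+3 & l2])
    && five_in p q (l1 ++ [:: q.+1, p.+3 & l2])
    && five_in p q (l1 ++ [:: q, p.+4 & l2])
    && five_in p q (l1 ++ [:: q.+1, p.+4 & l2]) ->
    excess ((l1 ++ [:: q, p.+3 & l2]) ++ R) + 1 <=
    excess ((l1 ++ [:: q.+1, p.+4 & l2]) ++ R).
  move=> /andP[/andP[/andP[/cR c1 /cR c2] /cR c3] /cR c4].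
  move: c1 c2 c3 c4; rewrite -!catA => c1 c2 c3 c4.
  by apply: excess_diamond.
(* Each [d] gains 1 and the jumps [j] lose nothing: a gain of 4 against the bound 3. Between two
   crossings the leader goes to its final site, the particle at [p+4] takes over site [q], and the
   next one comes up to [p+3]. *)
have d1 := D [::] [:: p.+2; p.+1; p] ltac:(five_in_tac).
have j1 := J [::] q.+1 q.+4 [:: p.+4; p.+2; p.+1; p] ltac:(five_in_tac).
have j2 := J [:: q.+4] p.+4 q [:: p.+2; p.+1; p] ltac:(five_in_tac).
have j3 := J [:: q.+4; q] p.+2 p.+3 [:: p.+1; p] ltac:(five_in_tac).
have d2 := D [:: q.+4] [:: p.+1; p] ltac:(five_in_tac).
have j4 := J [:: q.+4] q.+1 q.+3 [:: p.+4; p.+1; p] ltac:(five_in_tac).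
have j5 := J [:: q.+4; q.+3] p.+4 q [:: p.+1; p] ltac:(five_in_tac).
have j6 := J [:: q.+4; q.+3; q] p.+1 p.+3 [:: p] ltac:(five_in_tac).
have d3 := D [:: q.+4; q.+3] [:: p] ltac:(five_in_tac).
have j7 := J [:: q.+4; q.+3] q.+1 q.+2 [:: p.+4; p] ltac:(five_in_tac).
have j8 := J [:: q.+4; q.+3; q.+2] p.+4 q [:: p] ltac:(five_in_tac).
have j9 := J [:: q.+4; q.+3; q.+2; q] p p.+3 [::] ltac:(five_in_tac).
have d4 := D [:: q.+4; q.+3; q.+2] [::] ltac:(five_in_tac).
have := excess_le _ _ (cR [:: q; p.+3; p.+2; p.+1; p] ltac:(five_in_tac))
  (cR [:: q.+4; q.+3; q.+2; q.+1; p.+4] ltac:(five_in_tac)).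
by rewrite /= in d1 j1 j2 j3 d2 j4 j5 j6 d3 j7 j8 j9 d4 *; lia.
Qed.

Hypothesis h_ge5 : (5 <= h)%N.
Hypothesis k_large : (h + 12 <= k)%N.

Lemma gap_mid y : (3 <= y)%N -> (y + 4 < k)%N -> gap y = gap 3.
Proof.
move=> y3 yk; have [/eqP->//|y_neq3] := boolP (y == 3).
(* Gaps 3 and 4 are too close for a direct comparison, so both are compared with gap 6. *)
have [/eqP->|y_neq4] := boolP (y == 4).
  have -> : gap 4 = gap 6 by apply: (@gap_far 1); lia.
  by apply/esym/(@gap_far 0); lia.
by apply/esym/(@gap_far 0); lia.
Qed.

Lemma gap_multiple x : (x.+1 < k)%N ->
  exists2 q : nat, (0 < q <= 4)%N & gap x = q%:Z * gap 3.
Proof.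
move=> xk; have [x_mid|x_out] := boolP ((3 <= x) && (x + 4 < k))%N.
  by exists 1%N; rewrite // gap_mid; lia.
set d := gap 3.
have [d1|d1] := eqVneq (gap x) d; first by exists 1%N; lia.
have [d2|d2] := eqVneq (gap x) (2 * d); first by exists 2%N; lia.
have [d3|d3] := eqVneq (gap x) (3 * d); first by exists 3%N; lia.
have [d4|d4] := eqVneq (gap x) (4 * d); first by exists 4%N; lia.
(* One particle crosses from [x] to [x+1], another walks over the sites 5 to 9, which are clear of
   the outer gap. *)
have [||R cR] := @config_padding (x :: x.+1 :: iota 5 5) 2; rewrite //=; try lia.
have {}cR u t : (x <= u <= x.+1)%N -> (t <= 4)%N -> config ([:: u; (5 + t)%N] ++ R).
  move=> xu t4; apply: cR; rewrite /= ?inE; try lia.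
  by move=> i; rewrite !inE; lia.
have d_gt0 : 0 < d by rewrite subr_gt0 a_incr //; lia.
have a5 t : (t <= 4)%N -> a (5 + t) = a 5 + t%:Z * d.
  elim: t => [|t IHt] t4; first by rewrite addn0; lia.
  rewrite addnS; have := IHt ltac:(lia).
  have : gap (5 + t) = d by apply: gap_mid; lia.
  by rewrite /gap; lia.
have sE u t : (t <= 4)%N ->
    ssum ([:: u; (5 + t)%N] ++ R) = a u + a 5 + ssum R + t%:Z * d.
  by move=> t4; rewrite ssum_cat !ssum_cons a5 // /ssum big_nil; lia.
have gx : 0 < gap x by rewrite subr_gt0 a_incr.
(* Unless gap x is among d, 2d, 3d, 4d, these nine sums are distinct. *)
pose v := a x + a 5 + ssum R.
have S0 t : (t <= 4)%N -> v + t%:Z * d \in S.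
  by move=> t4; rewrite -sE //; apply/ssumS/cR; lia.
have S1 t : (t <= 4)%N -> v + gap x + t%:Z * d \in S.
  move=> t4.
  have -> : v + gap x = a x.+1 + a 5 + ssum R by rewrite /v /gap; lia.
  by rewrite -sE //; apply/ssumS/cR; lia.
have := excess_le _ _ (cR x 0%N ltac:(lia) isT) (cR x.+1 4%N ltac:(lia) isT).
rewrite /excess !sE // !sumn_cat /=.
have -> : a x.+1 + a 5 + ssum R + 4%:Z * d = v + gap x + 4%:Z * d.
  by rewrite /v /gap; lia.
have -> : a x + a 5 + ssum R + 0%:Z * d = v by rewrite /v; lia.
have /= := @below_add v (v + gap x + 4%:Z * d)
  [:: v + 0%:Z * d; v + 1%:Z * d; v + 2%:Z * d; v + 3%:Z * d; v + 4%:Z * d;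
      v + gap x + 0%:Z * d; v + gap x + 1%:Z * d; v + gap x + 2%:Z * d;
      v + gap x + 3%:Z * d].
move=> nine many; suff : False by [].
(* The position sum rises by 1 + 4 = 5 only, so nine sums would raise the excess by at least 4. *)
move: many; suff : (below v + 9 <= below (v + gap x + 4%:Z * d)%R)%N by lia.
apply: nine; rewrite ?inE; try lia.
- by apply/allP; cbn [all]; rewrite !S0 // !S1.
- by move=> z; rewrite !inE; lia.
Qed.

(** * The weighted sum of the outer gaps when inner gaps are 1 *)

Hypothesis gap3 : gap 3 = 1.

Lemma a_mid i : (3 <= i)%N -> (i + 4 <= k)%N -> a i = a 3 - 3 + i%:Z.
Proof.
move=> i3 ik; rewrite -(subnKC i3) in ik *.
elim: (i - 3)%N ik => [|n IHn] ik; first by rewrite addn0; lia.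
have := gap_mid (3 + n)%N ltac:(lia) ltac:(lia).
by rewrite gap3 /gap addnS IHn; lia.
Qed.

(* The particle at 6, which has three free steps of length 1 ahead, fills in the
   sums skipped when another particle crosses a gap of length at most 4. *)
Lemma cover l1 x n l2 :
  (forall i t, (i <= n)%N -> (t <= 3)%N ->
    config ((6 + t)%N :: l1 ++ (x + i)%N :: l2)) ->
  forall z : int,
  ssum (6%N :: l1 ++ x :: l2) <= z <= ssum (6%N :: l1 ++ (x + n)%N :: l2) ->
  z \in S.
Proof.
have a6 t : (t <= 3)%N -> a (6 + t) = a 6 + t%:Z.
  by move=> t3; rewrite (a_mid (6 + t)) ?(a_mid 6) //; lia.
have sE t u : (t <= 3)%N ->
    ssum ((6 + t)%N :: l1 ++ u :: l2) = a 6 + a u + ssum (l1 ++ l2) + t%:Z.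
  by move=> t3; rewrite ssum_cons !ssum_cat ssum_cons a6 //; lia.
have sE0 u := sE 0%N u isT; rewrite /= in sE0.
elim: n => [|n IHn] cfg z zz.
  move: zz; rewrite addn0 => zz; have -> : z = ssum (6%N :: l1 ++ x :: l2) by lia.
  by have := ssumS _ (cfg 0%N 0%N isT isT); rewrite !addn0.
have [zn|zn] := leP z (ssum (6%N :: l1 ++ (x + n)%N :: l2)).
  apply: IHn; last by lia.
  by move=> i t i_n; apply: cfg; lia.
have xk : ((x + n).+1 < k)%N.
  have /and3P[_ _ /=] := cfg n.+1 0%N (leqnn _) isT.
  by rewrite all_cat addnS => /and4P[].
have [q q4] := gap_multiple _ xk; rewrite gap3 /gap => gq.
rewrite addnS !sE0 in zz zn.
(* Here [j <= q]. If [j < q <= 4], the particle at 6 makes [j] steps instead of the crossing; if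
   [j = q], this is the sum after the crossing. *)
have [j zj] : exists j : nat, z = a 6 + a (x + n)%N + ssum (l1 ++ l2) + j%:Z.
  by exists `|z - (a 6 + a (x + n)%N + ssum (l1 ++ l2))%R|%N; lia.
have [jq|jq] := ltnP j q.
  by rewrite zj -sE; [apply/ssumS/cfg; lia | lia].
have := ssumS _ (cfg n.+1 0%N (leqnn _) isT); rewrite addnS sE //.
by congr (_ \in S); lia.
Qed.

(** By [cover] the count of sums grows by at least [a (x+n) - a x], while the position sum grows by
    [n]. *)
Lemma excess_gain l1 x n l2 :
  (forall i t, (i <= n)%N -> (t <= 3)%N ->
    config ((6 + t)%N :: l1 ++ (x + i)%N :: l2)) ->
  excess (6%N :: l1 ++ x :: l2) + (a (x + n)%N - a x) - n%:Z <=
  excess (6%N :: l1 ++ (x + n)%N :: l2).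
Proof.
move=> cfg; have cov := cover l1 x n l2 cfg.
have sE u : ssum (6%N :: l1 ++ u :: l2) = a 6 + a u + ssum (l1 ++ l2).
  by rewrite ssum_cons !ssum_cat ssum_cons; lia.
have xxn : a x <= a (x + n)%N.
  have /and3P[_ _ /=] := cfg n 0%N (leqnn _) isT.
  rewrite all_cat /= => /and4P[_ _ xk _].
  case: (n) xk => [|m] xk; first by rewrite addn0.
  by apply/ltW/a_incr; lia.
pose v := ssum (6%N :: l1 ++ x :: l2); pose m := `|(a (x + n)%N - a x)%R|%N.
have :=
  @below_add v (ssum (6%N :: l1 ++ (x + n)%N :: l2)) (mkseq (fun i => v + i%:Z) m).
rewrite size_mkseq /excess /= !sumn_cat /= -/v => many.
suff : (below v + m <= below (ssum (6%N :: l1 ++ (x + n)%N :: l2)))%N by lia.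
apply: many; rewrite /v ?sE; last by lia.
- by apply: mkseq_uniq => i j; lia.
- by move=> z /mapP[i]; rewrite mem_iota => im ->; apply: cov; rewrite !sE; lia.
- by move=> z /mapP[i]; rewrite mem_iota => im ->; lia.
Qed.

Definition four_in (l : seq nat) : bool :=
  [&& uniq l, size l == 4 & all (fun i => (i < 10) || (k - 6 <= i < k))%N l].

Local Ltac four_in_tac := rewrite /four_in /= ?inE; lia.

(** With unit inner gaps the left side is [3k - 9] plus the sum of [(i+1)(g_i - 1)] over both ends,
    so this bounds that sum by 3. *)
Lemma end_gaps_le :
  a (k - 3)%N + a (k - 2)%N + a (k - 1)%N - a 0%N - a 1%N - a 2%N
    <= 3 * k%:Z - 6.
Proof.
have [R cR] : exists R, forall l, four_in l -> config (l ++ R).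
  have [||R cR] := @config_padding (iota 0 10 ++ iota (k - 6) 6) 4 => //=; try lia.
  exists R => l /and3P[ul sl /allP lin]; apply: cR => //.
    by apply/allP => i /lin; lia.
  by move=> i /lin; rewrite mem_cat !mem_iota; lia.
have J l1 x y l2 :
    four_in (l1 ++ x :: l2) && four_in (l1 ++ y :: l2) && (x <= y)%N ->
    excess ((l1 ++ x :: l2) ++ R) <= excess ((l1 ++ y :: l2) ++ R).
  move=> /andP[/andP[/cR cx /cR cy] xy]; move: cx cy.
  by rewrite -!catA; move=> cx cy; apply: excess_jump.
have G l1 x l2 : (forall i t, (i <= 3)%N -> (t <= 3)%N ->
      four_in ((6 + t)%N :: l1 ++ (x + i)%N :: l2)) ->
    excess ((6%N :: l1 ++ x :: l2) ++ R) + (a (x + 3)%N - a x) - 3 <=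
    excess ((6%N :: l1 ++ (x + 3)%N :: l2) ++ R).
  move=> cfg; rewrite !cat_cons -!catA; apply: excess_gain => i t i3 t3.
  by have := cR _ (cfg i t i3 t3); rewrite cat_cons -catA.
(* Leader first, the particles at 0, 1, 2 advance by three sites over the lower gaps, jump to [k-6],
   [k-5], [k-4] without loss, and advance by three more over the upper gaps. *)
have g1 : excess ([:: 6; 0; 1; 2]%N ++ R) + (a 5 - a 2) - 3
    <= excess ([:: 6; 0; 1; 5]%N ++ R) := G [:: 0; 1]%N 2%N [::]
    ltac:(move=> i t i3 t3; four_in_tac).
have g2 : excess ([:: 6; 0; 1; 5]%N ++ R) + (a 4 - a 1%N) - 3
    <= excess ([:: 6; 0; 4; 5]%N ++ R) := G [:: 0]%N 1%N [:: 5]%N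
    ltac:(move=> i t i3 t3; four_in_tac).
have g3 : excess ([:: 6; 0; 4; 5]%N ++ R) + (a 3 - a 0%N) - 3
    <= excess ([:: 6; 3; 4; 5]%N ++ R) := G [::] 0%N [:: 4; 5]%N
    ltac:(move=> i t i3 t3; four_in_tac).
have j1 := J [:: 6; 3; 4]%N 5%N (k - 4)%N [::] ltac:(four_in_tac).
have j2 := J [:: 6; 3]%N 4%N (k - 5)%N [:: k - 4]%N ltac:(four_in_tac).
have j3 := J [:: 6]%N 3%N (k - 6)%N [:: k - 5; k - 4]%N ltac:(four_in_tac).
have g4 := G [:: k - 6; k - 5]%N (k - 4)%N [::]
    ltac:(move=> i t i3 t3; four_in_tac).
have g5 := G [:: k - 6]%N (k - 5)%N [:: k - 4 + 3]%N
    ltac:(move=> i t i3 t3; four_in_tac).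
have g6 := G [::] (k - 6)%N [:: k - 5 + 3; k - 4 + 3]%N
    ltac:(move=> i t i3 t3; four_in_tac).
have := excess_le _ _ (cR [:: 6; 0; 1; 2]%N ltac:(four_in_tac))
  (cR [:: 6; k - 6 + 3; k - 5 + 3; k - 4 + 3]%N ltac:(four_in_tac)).
have a34 := a_mid 4 ltac:(lia) ltac:(lia).
have a35 := a_mid 5 ltac:(lia) ltac:(lia).
have a3k4 := a_mid (k - 4)%N ltac:(lia) ltac:(lia).
have a3k5 := a_mid (k - 5)%N ltac:(lia) ltac:(lia).
have a3k6 := a_mid (k - 6)%N ltac:(lia) ltac:(lia).
have -> : (k - 3 = k - 6 + 3)%N by lia.
have -> : (k - 2 = k - 5 + 3)%N by lia.
have -> : (k - 1 = k - 4 + 3)%N by lia.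
move: g1 g2 g3 j1 j2 j3 g4 g5 g6; rewrite /=; lia.
Qed.

Hypothesis S_ssum : forall z, z \in S -> exists2 s, config s & z = ssum s.

Lemma ssum_move x y s : config (x :: s) -> config (y :: s) -> (x <= y)%N ->
  ssum (x :: s) <= ssum (y :: s).
Proof.
move=> _ /and3P[_ _ /andP[yk _]] xy; rewrite !ssum_cons lerD2r.
by have [->//|xy'] := eqVneq x y; apply/ltW/a_incr; lia.
Qed.

Lemma ssum_iota c m n : (forall i, (m <= i < m + n)%N -> a i = c + i%:Z) ->
  ssum (iota m n) = n%:Z * c + (sumn (iota m n))%:Z.
Proof.
elim: n m => [|n IHn] m ai; first by rewrite /ssum big_nil /=; lia.
rewrite /= ssum_cons ai; last by lia.
by rewrite IHn => [|i im]; [lia | apply: ai; lia].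
Qed.

(** All sums lie in [[lo, hi]], so [hi - lo] is at least [h(k-h) + 3]. The [h-3] inner terms
    contribute [(h-3)(k-h-3)] to it, and the outer ones supply the rest. *)
Lemma end_gaps_ge :
  3 * k%:Z - 6
    <= a (k - 3)%N + a (k - 2)%N + a (k - 1)%N - a 0%N - a 1%N - a 2%N.
Proof.
pose lo := ssum (iota 0 h); pose hi := ssum (iota (k - h) h).
have lohi : lo <= hi.
  apply: (config_min ssum h_le_k ssum_perm ssum_move (iota (k - h) h)).
  by apply: config_iota; lia.
have sz : (size S <= `|(hi - lo)%R|.+1)%N.
  rewrite -(size_mkseq (fun i => lo + i%:Z) `|(hi - lo)%R|.+1).
  apply: uniq_leq_size => // z.
  move=> /S_ssum[s cs ->].
  have := config_min ssum h_le_k ssum_perm ssum_move s cs.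
  have := config_max ssum h_le_k ssum_perm ssum_move s cs.
  rewrite -/lo -/hi => zhi zlo; apply/mapP; exists `|(ssum s - lo)%R|%N.
    by rewrite mem_iota; lia.
  by lia.
have loE : lo = a 0%N + a 1%N + a 2%N + ssum (iota 3 (h - 3)).
  have -> : lo = ssum ([:: 0; 1; 2]%N ++ iota 3 (h - 3)).
    by rewrite -[_ ++ _](iotaD 0 3) subnKC //; lia.
  by rewrite ssum_cat !ssum_cons /ssum big_nil; lia.
have hiE : hi = ssum (iota (k - h) (h - 3))
    + (a (k - 3)%N + a (k - 2)%N + a (k - 1)%N).
  have -> : hi = ssum (iota (k - h) (h - 3) ++ [:: k - 3; k - 2; k - 1]%N).
    have -> : [:: k - 3; k - 2; k - 1]%N = iota (k - h + (h - 3)) 3.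
      by rewrite /=; congr [:: _; _; _]; lia.
    by rewrite -iotaD subnK //; lia.
  by rewrite ssum_cat !ssum_cons /ssum big_nil; lia.
move: loE hiE; rewrite !(ssum_iota (a 3 - 3)); first last.
- by move=> i ih; apply: a_mid; lia.
- by move=> i ih; apply: a_mid; lia.
have := sumn_iota 3 0 (h - 3); have := sumn_iota (k - h) 0 (h - 3).
rewrite !addn0 => -> ->.
have : h%:Z * (k%:Z - h%:Z) = ((h - 3) * (k - h) + 3 * (k - h))%N.
  by rewrite -mulnDl subnK ?PoszM ?subzn //; lia.
by lia.
Qed.

End Configurations.

(** * From the set to its sorted enumeration, and the ten cases *)

Local Ltac listed_triple n x y z memA l c k_ge :=
  exists x, y, z; split;
  [ apply/fsetP => t; clear - memA l c k_ge;
    rewrite memA in_fsetD in_zint !inE; lia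
  | match goal with |- is_true (_ \in ?l) => exact (@mem_nth _ fset0 l n isT) end ].


Theorem theorem1p15 (h k : nat) (A : {fset int})
  (hh : (5 <= h)%N) (hk : (3 * h + 4 <= k)%N)
  (cardA : #|` A| = k)
  (minA : 0 \in A /\ (forall a : int, a \in A -> 0 <= a))
  (gcdA : fset_gcd A = 1)
  (cardhA : (#|` rsumset h A|)%:Z = h%:Z * k%:Z - h%:Z ^+ 2 + 4) :
  exists x y z : int,
    A = zint 0 (k%:Z + 2) `\` [fset x; y; z] /\
    ([fset x; y; z] : {fset int}) \in
      ([:: [fset 1; 2; 3];
           [fset k%:Z - 1; k%:Z; k%:Z + 1];
           [fset 1; 2; k%:Z + 1];
           [fset 1; k%:Z; k%:Z + 1];
           [fset 1; 3; k%:Z + 2];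
           [fset k%:Z - 2; k%:Z; k%:Z + 2];
           [fset 2; k%:Z; k%:Z + 2];
           [fset 1; k%:Z - 1; k%:Z + 2];
           [fset 3; k%:Z + 1; k%:Z + 2];
           [fset k%:Z - 3; k%:Z + 1; k%:Z + 2]] : seq {fset int}).
Proof.
have [A0 A_ge0] := minA.
pose s : seq int := sort <=%O (enum_fset A).
pose a (i : nat) : int := nth 0 s i.
pose S : seq int := enum_fset (rsumset h A).
have size_s : size s = k by rewrite size_sort -cardA.
have mem_s x : (x \in s) = (x \in A) by rewrite mem_sort.
have sorted_s : sorted <%O s by rewrite sort_lt_sorted fset_uniq.
have a_incr i j : (i < j)%N -> (j < k)%N -> a i < a j.
  by move=> ij jk; rewrite lt_sorted_ltn_nth // inE size_s //; lia.
have a_inj : {in [pred i | (i < k)%N] &, injective a}.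
  move=> i j ik jk aij; have [ij|ji|//] := ltngtP i j.
    by have := a_incr i j ij jk; rewrite aij ltxx.
  by have := a_incr j i ji ik; rewrite aij ltxx.
have aA i : (i < k)%N -> a i \in A by move=> ik; rewrite -mem_s mem_nth ?size_s.
have indexA x : x \in A -> (index x s < k)%N by rewrite -mem_s -index_mem size_s.
have a_index x : x \in A -> a (index x s) = x.
  by rewrite -mem_s => xs; rewrite /a nth_index.
have ssumS t : config h k t -> ssum a t \in S.
  move=> /and3P[ut /eqP st /allP tk]; apply/in_rsumset.
  have uat : uniq [seq a i | i <- t].
    by rewrite map_inj_in_uniq // => i j /tk ik /tk jk; apply: a_inj.
  exists [fset x in [seq a i | i <- t]]; split.
  - by apply/fsubsetP => x; rewrite inE => /mapP[i /tk ik ->]; apply: aA.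
  - by rewrite card_fseq undup_id // size_map.
  - rewrite /ssum -(big_map a xpredT id); apply: perm_big.
    by apply: uniq_perm; rewrite ?fset_uniq // => x; rewrite inE.
have S_ssum z : z \in S -> exists2 t, config h k t & z = ssum a t.
  move=> /in_rsumset[B [/fsubsetP BA cB ->]].
  exists [seq index x s | x <- enum_fset B].
    apply/and3P; split; last 1 first.
    - by apply/allP => _ /mapP[x /BA/indexA xk ->].
    - rewrite map_inj_in_uniq ?fset_uniq // => x y /BA xA /BA yA xy.
      by rewrite -(a_index x xA) xy a_index.
    - by rewrite size_map; apply/eqP.
  by rewrite /ssum big_map; apply: eq_big_seq => x /BA/a_index.
have sizeS : (size S)%:Z = h%:Z * (k%:Z - h%:Z) + 4.
  by have -> : size S = #|` rsumset h A| by []; rewrite cardhA; lia.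
have uniqS : uniq S by apply: fset_uniq.
have hk_le : (h <= k)%N by lia.
have k_large : (h + 12 <= k)%N by lia.
have a0 : a 0%N = 0.
  have := a_index 0 A0; case: (index 0 s) (indexA 0 A0) => // i ik ai.
  by have := a_incr 0%N i.+1 isT ik; have := A_ge0 _ (aA 0%N ltac:(lia)); lia.
have gapM := gap_multiple h k a S hk_le a_incr ssumS uniqS sizeS hh k_large.
(* This gap divides all gaps and [a 0 = 0], so it divides every element of [A] and hence the gcd. *)
have gap3 : gap a 3 = 1.
  have d_gt0 : 0 < gap a 3 by rewrite subr_gt0 a_incr //; lia.
  have : (gap a 3 %| fset_gcd A)%Z.
    apply/dvdz_fset_gcd => x xA; rewrite -(a_index x xA).
    elim: (index x s) (indexA x xA) => [|i IHi] ik; first by rewrite a0 dvdz0.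
    have [q _ gi] := gapM i ik.
    have /dvdzP[c ai] := IHi (ltnW ik); apply/dvdzP; exists (q%:Z + c).
    by rewrite mulrDl -gi -ai subrK.
  by rewrite gcdA dvdz1; lia.
have end_le := end_gaps_le h k a S hk_le a_incr ssumS uniqS sizeS hh k_large gap3.
have end_ge :=
  end_gaps_ge h k a S hk_le a_incr ssumS uniqS sizeS hh k_large gap3 S_ssum.
have amid := a_mid h k a S hk_le a_incr ssumS uniqS sizeS hh k_large gap3.
have memA x : (x \in A) = [|| x == 0, x == a 1%N, x == a 2%N,
    a 3%N <= x <= a 3%N + (k%:Z - 7), x == a (k - 3)%N, x == a (k - 2)%N
    | x == a (k - 1)%N].
  apply/idP/idP => [xA|]; last first.
    have [x_mid _|x_out] := boolP (a 3%N <= x <= a 3%N + (k%:Z - 7)).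
      have -> : x = a (3 + `|(x - a 3%N)%R|)%N by rewrite amid; lia.
      by apply: aA; lia.
    by rewrite /= => /or4P[|||/or3P[]] /eqP->; rewrite ?A0 // aA //; lia.
  (* The occurrence inside [index x s] is kept, so that the index can be generalized. *)
  have := indexA x xA; rewrite -{2 3 4 5 6 7 8 9}(a_index x xA).
  move: (index x s) => i ik.
  have [i_mid|] := boolP ((3 <= i) && (i + 4 <= k))%N.
    by rewrite (amid i); lia.
  move=> i_out.
  have : [|| i == 0, i == 1, i == 2, i == k - 3, i == k - 2 | i == k - 1]%N.
    by lia.
  by case/or4P => [||| /or3P[]] /eqP ->; rewrite ?a0 !eqxx ?orbT.
have := amid (k - 4)%N ltac:(lia) ltac:(lia).
have := a_incr 0%N 1%N isT ltac:(lia); have := a_incr 1%N 2%N isT ltac:(lia).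
have := a_incr 2%N 3%N isT ltac:(lia).
have := a_incr (k - 4)%N (k - 3)%N ltac:(lia) ltac:(lia).
have := a_incr (k - 3)%N (k - 2)%N ltac:(lia) ltac:(lia).
have := a_incr (k - 2)%N (k - 1)%N ltac:(lia) ltac:(lia).
rewrite a0 in end_le end_ge *.
move: (a (k - 4)%N) (a (k - 3)%N) (a (k - 2)%N) (a (k - 1)%N)
  (a 1%N) (a 2%N) (a 3%N) memA end_le end_ge => b4 b3 b2 b1 a1 a2 a3 memA.
move=> {gap3 gapM amid ssumS S_ssum a_incr aA}.
move=> end_le end_ge b21 b32 b43 a23 a12 a01 b4E.
have k_ge : (19 <= k)%N by lia.
(* The left side is 6 plus the lower end's share of the weighted sum. That share is at most 3, which
   leaves seven lower ends; the upper end makes up the rest of 3. *)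
have a_le : 3 * a3 - a1 - a2 <= 9 by lia.
have [l|n0] := boolP [&& a1 == 1, a2 == 2 & a3 == 3].
  have : [|| [&& b3 == k%:Z - 3, b2 == k%:Z - 2 & b1 == k%:Z + 2],
      [&& b3 == k%:Z - 3, b2 == k%:Z - 1 & b1 == k%:Z + 1]
    | [&& b3 == k%:Z - 2, b2 == k%:Z - 1 & b1 == k%:Z]] by lia.
  (* The first argument of [listed_triple] is the position of the triple in the list, counted from
     0. *)
  case/or3P => c.
  - by listed_triple 1%N (k%:Z - 1 : int) (k%:Z : int) (k%:Z + 1 : int) memA l c k_ge.
  - by listed_triple 5%N (k%:Z - 2 : int) (k%:Z : int) (k%:Z + 2 : int) memA l c k_ge.
  - by listed_triple 9%N (k%:Z - 3 : int) (k%:Z + 1 : int) (k%:Z + 2 : int) memA l c k_ge.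
have [l|n1] := boolP [&& a1 == 2, a2 == 3 & a3 == 4].
  have : [|| [&& b3 == k%:Z - 2, b2 == k%:Z - 1 & b1 == k%:Z + 2]
    | [&& b3 == k%:Z - 2, b2 == k%:Z & b1 == k%:Z + 1]] by lia.
  case/orP => c.
  - by listed_triple 3%N (1 : int) (k%:Z : int) (k%:Z + 1 : int) memA l c k_ge.
  - by listed_triple 7%N (1 : int) (k%:Z - 1 : int) (k%:Z + 2 : int) memA l c k_ge.
have [l|n2] := boolP [&& a1 == 3, a2 == 4 & a3 == 5].
  have c : [&& b3 == k%:Z - 1, b2 == k%:Z & b1 == k%:Z + 2] by lia.
  by listed_triple 2%N (1 : int) (2 : int) (k%:Z + 1 : int) memA l c k_ge.
have [l|n3] := boolP [&& a1 == 1, a2 == 3 & a3 == 4].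
  have c : [&& b3 == k%:Z - 2, b2 == k%:Z - 1 & b1 == k%:Z + 1] by lia.
  by listed_triple 6%N (2 : int) (k%:Z : int) (k%:Z + 2 : int) memA l c k_ge.
have [l|n4] := boolP [&& a1 == 4, a2 == 5 & a3 == 6].
  have c : [&& b3 == k%:Z, b2 == k%:Z + 1 & b1 == k%:Z + 2] by lia.
  by listed_triple 0%N (1 : int) (2 : int) (3 : int) memA l c k_ge.
have [l|n5] := boolP [&& a1 == 2, a2 == 4 & a3 == 5].
  have c : [&& b3 == k%:Z - 1, b2 == k%:Z & b1 == k%:Z + 1] by lia.
  by listed_triple 4%N (1 : int) (3 : int) (k%:Z + 2 : int) memA l c k_ge.
have [l|n6] := boolP [&& a1 == 1, a2 == 2 & a3 == 4].
  have c : [&& b3 == k%:Z - 2, b2 == k%:Z - 1 & b1 == k%:Z] by lia.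
  by listed_triple 8%N (3 : int) (k%:Z + 1 : int) (k%:Z + 2 : int) memA l c k_ge.
by move: a01 a12 a23 a_le n0 n1 n2 n3 n4 n5 n6; clear; lia.
Qed.
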